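(* Let $\vdash$ be a super-intuitionistic logic or a positive super-intuitionistic logic. If $\vdash$ is tabular, or more generally, if the theorems of $\vdash$ include the formula $h_n$ for some $n\in\omega$, then $\vdash$ has the infinite (deductive) Beth (definability) property.
   Context: The super-intuitionistic logics are the axiomatic extensions of intuitionistic propositional logic $\mathbf{IPL}$ (in the signature $\to,\wedge,\vee,\top,\bot$). The positive super-intuitionistic logics are the axiomatic extensions of the negation-less fragment of $\mathbf{IPL}$ (signature $\to,\wedge,\vee,\top$). A logic is identified with its deducibility relation $\vdash$. These logics are algebraized, respectively, by the varieties of Heyting algebras and of Brouwerian algebras (a Brouwerian algebra is an algebra $\langle A;\to,\wedge,\vee,\top\rangle$ whose $\wedge,\vee$ reduct is a lattice with top $\top$ and in which $x\wedge y\leqslant z\iff x\leqslant y\to z$; a Heyting algebra is a Brouwerian algebra with a distinguished least element $\bot$). A logic is tabular if the variety algebraizing it is finitely generated, i.e., generated by a finite algebra. The formulas $h_n$ are defined by $h_0 := y$ and $h_n := x_n\vee(x_n\to h_{n-1})$ for $n>0$, where $y,x_1,x_2,\dots$ are distinct variables. Write $\alpha\leftrightarrow\beta$ for $(\alpha\to\beta)\wedge(\beta\to\alpha)$. The infinite Beth property for $\vdash$ says the following. Let $X$ and $Z$ be disjoint sets of variables (of arbitrary, possibly infinite cardinality, arbitrarily many variables being available) and $\Gamma$ a (possibly infinite) set of formulas over $X\cup Z$. Suppose that $\Gamma\cup\sigma[\Gamma]\vdash z\leftrightarrow\sigma(z)$ for all $z\in Z$ and all uniform substitutions $\sigma$ (of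 formulas for variables) such that $\sigma(x)=x$ for all $x\in X$, where the formulas in the range of $\sigma|_{X\cup Z}$ may involve arbitrarily many variables beyond $X\cup Z$. Then for each $z\in Z$ there is a formula $\varphi_z$ over $X$ only such that $\Gamma\vdash z\leftrightarrow\varphi_z$. (It is assumed that $X\neq\emptyset$ unless the signature has constant symbols.) *)

(* Defs.v *)
From mathcomp Require Import all_boot all_order.
From mathcomp Require Import classical_sets cardinality.

Set Implicit Arguments.
Unset Strict Implicit.
Unset Printing Implicit Defensive.

Local Open Scope classical_set_scope.

(** The boolean [s] is the signature: [true] for ->, /\, \/, T, _|_ and [false]
    for its negation-less part.  The argument of [Bot] is a proof of [s = true],
    so [form false V] has no occurrence of _|_. *)
Inductive form (s : bool) (V : Type) : Type :=
| Var of V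
| Top
| Bot of s
| And of form s V & form s V
| Or of form s V & form s V
| Imp of form s V & form s V.

Arguments Var {s V}.
Arguments Top {s V}.
Arguments Bot {s V}.

Definition Iff s V (a b : form s V) : form s V := And (Imp a b) (Imp b a).

Fixpoint subst s V W (sigma : V -> form s W) (a : form s V) : form s W :=
  match a with
  | Var x => sigma x
  | Top => Top
  | Bot hs => Bot hs
  | And b c => And (subst sigma b) (subst sigma c)
  | Or b c => Or (subst sigma b) (subst sigma c)
  | Imp b c => Imp (subst sigma b) (subst sigma c)
  end.

Definition rename s V W (f : V -> W) : form s V -> form s W :=
  subst (fun x => Var (f x)).

(** Inclusion of the formulas of either signature into the full one. *)
Fixpoint to_full s V (a : form s V) : form true V :=
  match a with
  | Var x => Var x
  | Top => Top
  | Bot _ => Bot isT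
  | And b c => And (to_full b) (to_full c)
  | Or b c => Or (to_full b) (to_full c)
  | Imp b c => Imp (to_full b) (to_full c)
  end.

Inductive IPL (V : Type) (G : set (form true V)) : form true V -> Prop :=
| IPL_hyp a : G a -> IPL G a
| IPL_mp a b : IPL G (Imp a b) -> IPL G a -> IPL G b
| IPL_K a b : IPL G (Imp a (Imp b a))
| IPL_S a b c :
    IPL G (Imp (Imp a (Imp b c)) (Imp (Imp a b) (Imp a c)))
| IPL_andl a b : IPL G (Imp (And a b) a)
| IPL_andr a b : IPL G (Imp (And a b) b)
| IPL_and a b : IPL G (Imp a (Imp b (And a b)))
| IPL_orl a b : IPL G (Imp a (Or a b))
| IPL_orr a b : IPL G (Imp b (Or a b))
| IPL_or a b c :
    IPL G (Imp (Imp a c) (Imp (Imp b c) (Imp (Or a b) c)))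
| IPL_top : IPL G Top
| IPL_bot a : IPL G (Imp (Bot isT) a).

(** The sets of variables all live in one universe, so that logics, axiomatic
    extensions, algebraization and the Beth property range over the same sets. *)
Definition varset := Type.

(** A logic is a deducibility relation, given over every set of variables. *)
Definition deducibility (s : bool) : Type :=
  forall V : varset, set (form s V) -> form s V -> Prop.

(** For [s = true] this is IPL itself, as [to_full] is then the identity. *)
Definition IPL_fragment (s : bool) : deducibility s :=
  fun V G a => IPL (@to_full s V @` G) (to_full a).

(** Since formulas are finite, it is no restriction to write the axiom schemes
    in the variables [nat]. *)
Definition instances s (Ax : set (form s nat)) (V : varset) : set (form s V) :=
  [set b | exists2 a, Ax a & exists sigma : nat -> form s V, b = subst sigma a].

Arguments instances {s} Ax V.

(** The super-intuitionistic logics for [s = true], and the positive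
    super-intuitionistic logics for [s = false]. *)
Definition superintuitionistic s (L : deducibility s) : Prop :=
  exists Ax : set (form s nat), forall (V : varset) (G : set (form s V)) a,
    L V G a <-> IPL_fragment (G `|` instances Ax V) a.

Record brouwerian := Brouwerian {
  brouwerian_disp : Order.disp_t;
  brouwerian_sort :> tLatticeType brouwerian_disp;
  bimp : brouwerian_sort -> brouwerian_sort -> brouwerian_sort;
  bimpP : forall x y z, (Order.meet x y <= z)%O = (x <= bimp y z)%O
}.

(** Heyting algebras for [s = true]; for [s = false] there is no proof of [s],
    hence no distinguished element, and these are the Brouwerian algebras. *)
Record algebra (s : bool) := Algebra {
  algebra_brouwerian :> brouwerian;
  abot : s -> algebra_brouwerian;
  abot_le : forall (hs : s) x, (abot hs <= x)%O
}.

Fixpoint eval s (A : algebra s) V (v : V -> A) (a : form s V) : A :=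
  match a with
  | Var x => v x
  | Top => Order.top
  | Bot hs => abot A hs
  | And b c => Order.meet (eval v b) (eval v c)
  | Or b c => Order.join (eval v b) (eval v c)
  | Imp b c => bimp (eval v b) (eval v c)
  end.

Definition equation (s : bool) : Type := (form s nat * form s nat)%type.

Definition models s (E : set (equation s)) (A : algebra s) : Prop :=
  forall e, E e -> forall v : nat -> A, eval v e.1 = eval v e.2.

(** Classes of algebras are plain predicates because [algebra s] is too large
    for the universe of [set]. *)
Definition variety s (K : algebra s -> Prop) : Prop :=
  exists E : set (equation s), forall A, K A <-> models E A.

(** [K] is the smallest variety containing [A]. *)
Definition generated_by s (K : algebra s -> Prop) (A : algebra s) : Prop :=
  [/\ variety K, K A & forall K' : algebra s -> Prop,
      variety K' -> K' A -> forall B, K B -> K' B].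

Definition finitely_generated s (K : algebra s -> Prop) : Prop :=
  exists A : algebra s, finite_set [set: A] /\ generated_by K A.

(** Algebraization in the sense of Blok and Pigozzi, with defining equation
    x = T and equivalence formula x <-> y. *)
Definition algebraizes s (K : algebra s -> Prop) (L : deducibility s) : Prop :=
  (forall (V : varset) (G : set (form s V)) a,
     L V G a <->
     forall A, K A -> forall v : V -> A,
       (forall g, G g -> eval v g = Order.top) -> eval v a = Order.top) /\
  (forall A, K A -> forall (V : varset) (a b : form s V) (v : V -> A),
     eval v a = eval v b <-> eval v (Iff a b) = Order.top).

Definition tabular s (L : deducibility s) : Prop :=
  exists K : algebra s -> Prop,
    [/\ variety K, algebraizes K L & finitely_generated K].

(** The variable y is 0 and x_n is n. *)
Fixpoint h s (n : nat) : form s nat :=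
  match n with
  | 0 => Var 0
  | m.+1 => Or (Var m.+1) (Imp (Var m.+1) (h s m))
  end.

(** The disjoint sets of variables X and Z are types, and X + Z is their union;
    Y supplies the further variables that may occur in the values of sigma.
    No condition is needed when X is empty, since T belongs to both
    signatures. *)
Definition infinite_Beth s (L : deducibility s) : Prop :=
  forall (X Z : varset) (G : set (form s (X + Z))),
    (forall (Y : varset) (sigma : X + Z -> form s ((X + Z) + Y)),
       (forall x : X, sigma (inl x) = Var (inl (inl x))) ->
       forall z : Z,
         L ((X + Z) + Y)%type ((rename inl @` G) `|` (subst sigma @` G))
           (Iff (Var (inl (inr z))) (sigma (inr z)))) ->
    forall z : Z, exists phi : form s X,
      L (X + Z)%type G (Iff (Var (inr z)) (rename inl phi)).

(* Main.v *)
Require Import Defs.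
From mathcomp Require Import all_boot all_order.
From mathcomp Require Import boolp.
From mathcomp Require Import classical_sets cardinality.

Set Implicit Arguments.
Unset Strict Implicit.
Unset Printing Implicit Defensive.

Import Order.Theory.

Local Open Scope classical_set_scope.

(** Call a set of formulas a theory if it contains the axioms of the logic and
    is closed under deduction, and let A be the set of formulas over X.  The
    proof has two halves.

    Rigidity ([Beth_rigid]).  Let T and T' be theories containing G that have
    the same members in A, and suppose that every formula is T-equivalent to a
    member of A.  Then T = T'.  Indeed, choose for each variable v a formula
    rho v in A that is T-equivalent to v, with rho x = x on X.  Every formula b
    is T-equivalent to its image under rho, so the images of the members of G
    lie in T and in A, hence in T'.  The hypothesis of the Beth property,
    applied to rho, now says that T' proves z <-> rho z for all z in Z, so b is
    also T'-equivalent to its image under rho.  Thus b and its image, on which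
    T and T' agree, belong to both theories or to neither.

    Bounded depth ([represents_of_depth]).  If T0 is the theory generated by
    G, it has to be shown that every formula is T0-equivalent to a member of A.
    Call the intersection of a theory with A its trace.  If among the prime
    theories extending T each is determined by its trace, then every formula is
    T-equivalent to a member of A ([represents_of_injective]); so it is enough
    to see that every prime extension P of T0 is determined by its trace.  This
    is done by induction on the n for which P contains the instances of h_n by
    members of A.  Let M be an extension of P that is maximal among those with
    the same trace.  A prime R properly containing M has a larger trace, which
    contains the instances of h_(n-1), so it is determined by its trace; if
    n = 0 there is no such R, as P already contains A.  Hence every prime
    extension of M is determined by its trace, every formula is M-equivalent to
    a member of A, and rigidity makes M the only extension of T0 with its
    trace.

    In terms of Esakia duality, traces give a p-morphism of dual spaces, and
    the induction shows that its fibres are singletons, from the top downwards.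

    A tabular logic proves some h_n because in a finite algebra the values of
    h_0, h_1, h_2, ... increase strictly until they reach the top element
    ([finite_h]). *)

(** * Substitution and replacement of hypotheses *)

Lemma subst_subst s U V W (sigma : U -> form s V) (tau : V -> form s W) a :
  subst tau (subst sigma a) = subst (fun x => subst tau (sigma x)) a.
Proof. by elim: a => //= b -> c ->. Qed.

Lemma to_full_subst s V W (sigma : V -> form s W) a :
  to_full (subst sigma a) = subst (fun x => to_full (sigma x)) (to_full a).
Proof. by elim: a => //= b -> c ->. Qed.

(** Only the variables up to [n] occur in [h s n], so the value given to
    [n.+1] can be chosen without disturbing an instance of [h s n]. *)
Lemma subst_h s V (sigma tau : nat -> form s V) n :
  (forall i, i <= n -> sigma i = tau i) ->
  subst sigma (h s n) = subst tau (h s n).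
Proof.
elim: n => [|n IHn] eq_st /=; first exact: eq_st.
by rewrite eq_st // IHn // => i le_in; apply: eq_st; apply: leqW.
Qed.

Lemma IPL_subset V (G H : set (form true V)) a :
  G `<=` H -> IPL G a -> IPL H a.
Proof.
move=> sGH; elim=> {a}; try by constructor.
- by move=> a /sGH Ha; apply: IPL_hyp.
- by move=> a b _ Hab _; apply: IPL_mp.
Qed.

Lemma IPL_subst V W (tau : V -> form true W) G a :
  IPL G a -> IPL (subst tau @` G) (subst tau a).
Proof.
elim=> {a} /=; try by constructor.
by move=> a b _ Hab _; apply: IPL_mp.
Qed.

Lemma IPL_const V (G : set (form true V)) a b : IPL G b -> IPL G (Imp a b).
Proof. by apply: IPL_mp; apply: IPL_K. Qed.

Lemma IPL_imp_mp V (G : set (form true V)) a b c :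
  IPL G (Imp a (Imp b c)) -> IPL G (Imp a b) -> IPL G (Imp a c).
Proof. by move=> Habc; apply: IPL_mp; apply: IPL_mp Habc; apply: IPL_S. Qed.

Lemma IPL_id V (G : set (form true V)) a : IPL G (Imp a a).
Proof. by apply: (IPL_imp_mp (b := Imp a a)); apply: IPL_K. Qed.

Lemma IPL_imp_trans V (G : set (form true V)) a b c :
  IPL G (Imp a b) -> IPL G (Imp b c) -> IPL G (Imp a c).
Proof. by move=> Hab Hbc; apply: IPL_imp_mp Hab; apply: IPL_const. Qed.

(** * Theories *)

Definition theory s (Ax : set (form s nat)) V (T : set (form s V)) : Prop :=
  instances Ax V `<=` T /\ forall a, IPL_fragment T a -> T a.

(** The set of all formulas counts as prime.  Indeed the negation-less signature
    cannot express inconsistency, and a proper theory may contain every formula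
    over X. *)
Definition prime s V (T : set (form s V)) : Prop :=
  forall a b, T (Or a b) -> T a \/ T b.

(** When [U] is nonempty and directed (downwards, modulo [T]-provable
    implication), this is the theory generated by [T] and [U]. *)
Definition adjoin s V (T U : set (form s V)) : set (form s V) :=
  [set b | exists2 u, U u & T (Imp u b)].

Definition agree_on s V (A T T' : set (form s V)) : Prop :=
  forall a, A a -> (T a <-> T' a).

(** The inclusion of A into the Lindenbaum algebra of [T] is onto. *)
Definition represents s V (A T : set (form s V)) : Prop :=
  forall b, exists2 a, A a & T (Iff b a).

Section Theories.
Variables (s : bool) (Ax : set (form s nat)) (V : Type).
Implicit Types (T U I A : set (form s V)) (a b c : form s V).

Local Notation theory := (theory Ax).

Lemma theory_mp T a b : theory T -> T (Imp a b) -> T a -> T b.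
Proof.
move=> [_ clT] Tab Ta; apply: clT; apply: (IPL_mp (a := to_full a)).
  by apply: IPL_hyp; exists (Imp a b).
by apply: IPL_hyp; exists a.
Qed.

Lemma theory_const T a b : theory T -> T b -> T (Imp a b).
Proof.
by move=> thT; apply: (theory_mp thT); apply: thT.2; apply: IPL_K.
Qed.

Lemma theory_id T a : theory T -> T (Imp a a).
Proof. by move=> thT; apply: thT.2; apply: IPL_id. Qed.

Lemma theory_top T : theory T -> T Top.
Proof. by move=> thT; apply: thT.2; apply: IPL_top. Qed.

Lemma theory_and T a b : theory T -> T (And a b) <-> T a /\ T b.
Proof.
move=> thT; split=> [Tab|[Ta Tb]]; last first.
  apply: (theory_mp thT) Tb; apply: (theory_mp thT) Ta.
  by apply: thT.2; apply: IPL_and.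
split; apply: (theory_mp thT) Tab; apply: thT.2.
- exact: IPL_andl.
- exact: IPL_andr.
Qed.

Lemma theory_orl T a b : theory T -> T a -> T (Or a b).
Proof. by move=> thT; apply: (theory_mp thT); apply: thT.2; apply: IPL_orl. Qed.

Lemma theory_orr T a b : theory T -> T b -> T (Or a b).
Proof. by move=> thT; apply: (theory_mp thT); apply: thT.2; apply: IPL_orr. Qed.

Lemma theory_or_imp T a b c : theory T ->
  T (Imp a c) -> T (Imp b c) -> T (Imp (Or a b) c).
Proof.
move=> thT Tac; apply: (theory_mp thT); apply: (theory_mp thT) Tac.
by apply: thT.2; apply: IPL_or.
Qed.

(** A deduction theorem.  The induction is on derivations in the full
    signature, which may pass through formulas with _|_ even when [s] is
    [false]; this is why it speaks of [c : form true V]. *)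
Lemma theory_adjoin T U : theory T -> U !=set0 ->
  (forall u v, U u -> U v -> exists w, [/\ U w, T (Imp w u) & T (Imp w v)]) ->
  theory (adjoin T U).
Proof.
move=> thT [u0 Uu0] dirU; split=> [b /thT.1 Tb|b].
  by exists u0 => //; apply: theory_const.
suff deduction (c : form true V) : IPL (@to_full s V @` adjoin T U) c ->
    exists2 u, U u & IPL (@to_full s V @` T) (Imp (to_full u) c).
  by move=> /deduction [u Uu Hub]; exists u => //; apply: thT.2.
elim=> {c}; try by move=> *; exists u0 => //; apply: IPL_const; constructor.
- by move=> _ [c [u Uu Tuc] <-]; exists u => //; apply: IPL_hyp;
    exists (Imp u c).
- move=> c d _ [u Uu Hucd] _ [v Uv Hvc].
  have [w [Uw Twu Twv]] := dirU u v Uu Uv.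
  exists w => //; apply: (IPL_imp_mp (b := c)).
    by apply: IPL_imp_trans Hucd; apply: IPL_hyp; exists (Imp w u).
  by apply: IPL_imp_trans Hvc; apply: IPL_hyp; exists (Imp w v).
Qed.

Lemma subset_adjoin T U : theory T -> U !=set0 -> T `<=` adjoin T U.
Proof. by move=> thT [u Uu] b Tb; exists u => //; apply: theory_const. Qed.

Lemma adjoin_subset T U : theory T -> U `<=` adjoin T U.
Proof. by move=> thT u Uu; exists u => //; apply: theory_id. Qed.

Lemma theory_adjoin1 T a : theory T -> theory (adjoin T [set a]).
Proof.
move=> thT; apply: theory_adjoin => //; first by exists a.
by move=> _ _ -> ->; exists a; split=> //; apply: theory_id.
Qed.

(** Implication read as in a Kripke model whose worlds are the theories.  With
    the next lemmas it replaces derivations by reasoning on membership. *)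
Lemma theory_imp T a b : theory T ->
  T (Imp a b) <-> forall T', theory T' -> T `<=` T' -> T' a -> T' b.
Proof.
move=> thT; split=> [Tab T' thT' sTT'|all_ext].
  by apply: (theory_mp thT'); apply: sTT'.
have [|||_ -> //] := all_ext (adjoin T [set a]).
- exact: theory_adjoin1.
- by apply: subset_adjoin => //; exists a.
- exact: adjoin_subset.
Qed.

Lemma theory_iff T a b : theory T ->
  T (Iff a b) <-> forall T', theory T' -> T `<=` T' -> (T' a <-> T' b).
Proof.
move=> thT; rewrite /Iff (theory_and _ _ thT) !theory_imp //; split.
  by move=> [Hab Hba] T' thT' sTT'; split; [apply: Hab|apply: Hba].
by move=> H; split=> T' thT' sTT'; case: (H T' thT' sTT').
Qed.

Lemma theory_or_elim T a b c : theory T -> T (Or a b) ->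
  (forall T', theory T' -> T `<=` T' -> T' a -> T' c) ->
  (forall T', theory T' -> T `<=` T' -> T' b -> T' c) -> T c.
Proof.
move=> thT Tab Hac Hbc; apply: (theory_mp thT) Tab.
by apply: theory_or_imp => //; apply/theory_imp.
Qed.

Lemma theory_replace T (rho : V -> form s V) : theory T ->
  (forall x, T (Iff (Var x) (rho x))) -> forall b, T (Iff b (subst rho b)).
Proof.
move=> thT Trho; elim=> [x||hs|b IHb c IHc|b IHb c IHc|b IHb c IHc] //=;
  apply/(theory_iff _ _ thT) => T' thT' sTT' //;
  move: (IHb) (IHc) => /(theory_iff _ _ thT) ib /(theory_iff _ _ thT) ic.
- by rewrite !(theory_and _ _ thT') ib // ic.
- split=> /(theory_or_elim thT'); apply=> T'' thT'' sT'T'';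
    have sTT'' := subset_trans sTT' sT'T''.
  + by move=> /(ib _ thT'' sTT''); apply: theory_orl.
  + by move=> /(ic _ thT'' sTT''); apply: theory_orr.
  + by move=> /(ib _ thT'' sTT''); apply: theory_orl.
  + by move=> /(ic _ thT'' sTT''); apply: theory_orr.
- rewrite !(theory_imp _ _ thT'); split=> H T'' thT'' sT'T'';
    have sTT'' := subset_trans sTT' sT'T''; move: (H T'' thT'' sT'T'').
  + by rewrite ib // ic.
  + by rewrite -ib // -ic.
Qed.

(** A derivation uses finitely many hypotheses, hence a single member of the
    chain, or only [T].  Keeping [T] apart lets the chain be empty, as the form
    of Zorn's lemma used below requires. *)
Lemma theory_chain T (F : set (set (form s V))) : theory T ->
  (forall X, F X -> theory (T `|` X)) -> total_on F subset ->
  theory (T `|` \bigcup_(X in F) X).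
Proof.
move=> thT thF totF; split=> [b /thT.1 Tb|b]; first by left.
pose D X (c : form true V) := IPL (@to_full s V @` (T `|` X)) c.
suff finitary (c : form true V) :
    D (\bigcup_(X in F) X) c -> D set0 c \/ exists2 X, F X & D X c.
  move=> /finitary [|[X FX]].
    by rewrite /D setU0 => /thT.2; left.
  by move=> /(thF X FX).2 [|Xb]; [left|right; exists X].
have D0 X (d : form true V) : D set0 d -> D X d.
  by apply: IPL_subset; apply: image_subset; apply: setUS.
have DS X X' (d : form true V) : X `<=` X' -> D X d -> D X' d.
  by move=> sXX'; apply: IPL_subset; apply: image_subset; apply: setUS.
elim=> {c}; try by move=> *; left; constructor.
- move=> _ [c [Tc|[X FX Xc]] <-].
    by left; apply: IPL_hyp; exists c; first left.
  by right; exists X => //; apply: IPL_hyp; exists c; first right.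
- move=> c d _ [Hcd|[X FX Hcd]] _ [Hc|[X' FX' Hc]].
  + by left; apply: IPL_mp Hc.
  + by right; exists X' => //; apply: IPL_mp Hc; apply: D0.
  + by right; exists X => //; apply: IPL_mp Hcd _; apply: D0.
  + have [sXX'|sX'X] := totF X X' FX FX'.
      by right; exists X' => //; apply: IPL_mp Hc; apply: DS Hcd.
    by right; exists X => //; apply: IPL_mp Hcd _; apply: DS Hc.
Qed.

(** * Prime theories *)

(** Among the extensions of [T] that avoid [I], Zorn's lemma gives a maximal
    one.  If it contained [Or a b] but neither [a] nor [b], then together with
    [a] it would prove some [c] in [I], together with [b] some [d] in [I], and
    so by itself [Or c d], which is in [I].  An empty [I] is harmless, since
    the set of all formulas is prime. *)
Lemma prime_extension T I : theory T ->
  (forall a b, I a -> I b -> I (Or a b)) ->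
  (forall a, I a -> ~ T a) ->
  exists R, [/\ theory R, prime R, T `<=` R, forall a, I a -> ~ R a &
    forall R', theory R' -> R `<=` R' -> (forall a, I a -> ~ R' a) ->
      R' `<=` R].
Proof.
move=> thT orI TI.
pose P X := theory (T `|` X) /\ forall a, I a -> ~ (T `|` X) a.
have [F FP totF|X [[thX XI] maxX]] := Zorn_bigcup (P := P).
  split; first by apply: theory_chain => // X /FP [].
  move=> a Ia [/TI|[X FX Xa]]; first exact.
  by have [_ /(_ a Ia)] := FP X FX; apply; right.
have maxR R' : theory R' -> T `|` X `<=` R' -> (forall a, I a -> ~ R' a) ->
    R' `<=` T `|` X.
  move=> thR' sXR' R'I; apply: contrapT => nsR'X.
  have TR' : T `|` R' = R'.
    by apply/setUidPr; apply: subset_trans sXR'; apply: subsetUl.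
  apply: (maxX R'); last by rewrite /P TR'.
  split; first by apply: subset_trans sXR'; apply: subsetUr.
  by move=> sR'X; apply: nsR'X; apply: (subset_trans sR'X); apply: subsetUr.
exists (T `|` X); split=> //.
have meetsI c : ~ (T `|` X) c -> exists2 a, I a & (T `|` X) (Imp c a).
  move=> nXc; apply: contrapT => noI; apply: nXc.
  apply: (maxR (adjoin (T `|` X) [set c])).
  - exact: theory_adjoin1.
  - by apply: subset_adjoin => //; exists c.
  - by move=> a Ia [_ -> Xca]; apply: noI; exists a.
  - exact: adjoin_subset.
move=> a b Xab; apply: contrapT => /not_orP.
move=> [/meetsI [c Ic Xac] /meetsI [d Id Xbd]].
apply: (XI (Or c d)); first exact: orI.
apply: (theory_or_elim thX Xab) => R thR sXR.
- by move=> /(theory_mp thR (sXR _ Xac)); apply: theory_orl.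
- by move=> /(theory_mp thR (sXR _ Xbd)); apply: theory_orr.
Qed.

Section Subalgebra.
Variable A : set (form s V).
Hypotheses (A_top : A Top) (A_and : forall a b, A a -> A b -> A (And a b))
  (A_or : forall a b, A a -> A b -> A (Or a b))
  (A_imp : forall a b, A a -> A b -> A (Imp a b)).

Lemma theory_adjoin_trace T R : theory T -> theory R ->
  theory (adjoin T (A `&` R)).
Proof.
move=> thT thR; apply: theory_adjoin => //.
  by exists Top; split=> //; apply: theory_top.
move=> u v [Au Ru] [Av Rv]; exists (And u v); split.
- by split; [apply: A_and|apply/theory_and].
- by apply: thT.2; apply: IPL_andl.
- by apply: thT.2; apply: IPL_andr.
Qed.

(** The trace map is a p-morphism: a prime theory whose trace contains that of
    [R] has the same trace as some prime extension of [R].  The theory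
    generated by [R] and the trace of [Q] has no member in A outside [Q],
    because A is closed under implication; extend it, avoiding the members of A
    outside [Q]. *)
Lemma lift_trace R Q : theory R -> theory Q -> prime Q ->
  A `&` R `<=` Q ->
  exists R', [/\ theory R', prime R', R `<=` R' & agree_on A R' Q].
Proof.
move=> thR thQ prQ sRQ.
have AQ0 : A `&` Q !=set0 by exists Top; split=> //; apply: theory_top.
have orI a b : (A `\` Q) a -> (A `\` Q) b -> (A `\` Q) (Or a b).
  by move=> [Aa Qa] [Ab Qb]; split; [apply: A_or|move=> /prQ []].
have [a [Aa Qa] [u [Au Qu] Rua]|R' [thR' prR' sRR' R'I _]] :=
    prime_extension (theory_adjoin_trace thR thQ) orI.
  apply: Qa; apply: theory_mp Qu => //; apply: sRQ; split=> //.
  exact: A_imp.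
exists R'; split=> //.
  by apply: subset_trans sRR'; apply: subset_adjoin.
move=> a Aa; split=> [R'a|Qa].
  by apply: contrapT => Qa; apply: (R'I a).
by apply: sRR'; apply: adjoin_subset.
Qed.

(** Suppose that [b] is not [T]-equivalent to a member of A.  Then some prime
    [R] contains [b] but no member of A that [T]-implies [b].  Consequently
    [T] with the trace of [R] does not prove [b], and some prime [Q] whose
    trace contains that of [R] omits [b].  Lifting the trace of [Q] above [R]
    gives a prime that contains [b] and has the same trace as [Q]. *)
Lemma represents_of_injective T : theory T ->
  (forall R Q, theory R -> theory Q -> prime R -> prime Q ->
    T `<=` R -> T `<=` Q -> agree_on A R Q -> R `<=` Q) ->
  represents A T.
Proof.
move=> thT injT b; apply: contrapT => undef.
pose I : set (form s V) := [set a | A a /\ T (Imp a b)].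
have orI a c : I a -> I c -> I (Or a c).
  by move=> [Aa Tab] [Ac Tcb]; split; [apply: A_or|apply: theory_or_imp].
have [a [Aa Tab] [_ -> Tba]|R [thR prR sTR RI _]] :=
    prime_extension (theory_adjoin1 b thT) orI.
  by apply: undef; exists a => //; apply/theory_and.
have Rb : R b by apply: sTR; apply: adjoin_subset.
have {}sTR : T `<=` R.
  by apply: subset_trans sTR; apply: subset_adjoin => //; exists b.
have orJ a c : T (Imp a b) -> T (Imp c b) -> T (Imp (Or a c) b).
  exact: theory_or_imp.
have AR0 : A `&` R !=set0 by exists Top; split=> //; apply: theory_top.
have [a Tab [u [Au Ru] Tua]|Q [thQ prQ sTQ QJ _]] :=
    prime_extension (I := [set a | T (Imp a b)])
      (theory_adjoin_trace thT thR) orJ.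
  apply: (RI u) => //; split=> //.
  apply/theory_imp => // T' thT' sTT' T'u.
  exact: theory_mp (sTT' _ Tab) (theory_mp thT' (sTT' _ Tua) T'u).
apply: (QJ b); first exact: theory_id.
have sRQ : A `&` R `<=` Q.
  by apply: subset_trans sTQ; apply: adjoin_subset.
have [R' [thR' prR' sRR' R'Q]] := lift_trace thR thQ prQ sRQ.
apply: (injT R') => //; last exact: sRR'.
- exact: subset_trans sRR'.
- by apply: subset_trans sTQ; apply: subset_adjoin.
Qed.

(** * Finite depth *)

Variable T0 : set (form s V).
Hypothesis rigid : forall T T', theory T -> theory T' ->
  T0 `<=` T -> T0 `<=` T' -> represents A T -> agree_on A T T' -> T = T'.

(** If primes whose trace is larger than that of [P] are determined by their
    trace, then so is [P]: the fibre of [P] has a maximal member [M], whose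
    prime extensions are all determined by their trace, so that rigidity
    applies to [M]. *)
Lemma prime_determined_step P Q : theory P -> prime P -> theory Q ->
  T0 `<=` P -> T0 `<=` Q -> agree_on A P Q ->
  (forall a R R', theory R -> theory R' -> prime R -> T0 `<=` R -> T0 `<=` R' ->
    A a -> R a -> ~ P a -> A `&` P `<=` R -> agree_on A R R' -> R = R') ->
  P = Q.
Proof.
move=> thP prP thQ sP sQ PQ above.
have orI a b : (A `\` P) a -> (A `\` P) b -> (A `\` P) (Or a b).
  by move=> [Aa Pa] [Ab Pb]; split; [apply: A_or|move=> /prP []].
have [a [_ Pa] //|M [thM prM sPM MI maxM]] := prime_extension thP orI.
have MP : agree_on A M P.
  move=> a Aa; split=> [Ma|]; last exact: sPM.
  by apply: contrapT => Pa; apply: (MI a).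
have sM := subset_trans sP sPM.
have repM : represents A M.
  apply: represents_of_injective => // R R' thR thR' prR prR' sMR sMR' RR'.
  (* A prime extension of M has a larger trace, or it is contained in M. *)
  have [[a [[Aa Pa] Ra]]|nmeet] := pselect (exists a, (A `\` P) a /\ R a).
    rewrite (above a R R') //; try exact: subset_trans sMR'.
    - exact: subset_trans sMR.
    - by move=> b [_ /sPM /sMR].
  apply: subset_trans sMR'; apply: maxM => // a Ia Ra.
  by apply: nmeet; exists a.
rewrite -(rigid thM thP sM sP repM MP); apply: rigid => // a Aa.
by rewrite MP // PQ.
Qed.

(** The assumption concerns only instances by members of A because these belong
    to the trace, and so pass from [P] to the theories with a larger trace, in
    which they yield the instances of the next lower formula. *)
Lemma prime_determined n : forall P Q, theory P -> prime P -> theory Q ->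
  T0 `<=` P -> T0 `<=` Q -> agree_on A P Q ->
  (forall sigma : nat -> form s V, (forall i, A (sigma i)) ->
    P (subst sigma (h s n))) ->
  P = Q.
Proof.
elim: n => [|n IHn] P Q thP prP thQ sP sQ PQ hP;
  apply: prime_determined_step => // a R R' thR thR' prR sR sR' Aa Ra Pa;
  move=> sPR RR'.
- by case: Pa; apply: (hP (fun=> a)).
- apply: IHn => // sigma Asigma.
  (* As a is outside P, the instance Or a (Imp a _) of h_(n+1) gives P the
     implication, and then R, which contains a, the instance of h_n. *)
  pose sigma' i := if i == n.+1 then a else sigma i.
  have Asigma' i : A (sigma' i) by rewrite /sigma'; case: ifP.
  have Ah : A (subst sigma' (h s n)).
    by elim: (n) => [|m IHm] /=; auto.
  have := hP sigma' Asigma'; rewrite /= {1 2}/sigma' eqxx => /prP [//|Pah].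
  rewrite (@subst_h _ _ sigma sigma'); last first.
    by move=> i le_in; rewrite /sigma' ltn_eqF // ltnS.
  by apply: (theory_mp thR _ Ra); apply: sPR; split=> //; apply: A_imp.
Qed.

Lemma represents_of_depth n : theory T0 ->
  (forall sigma : nat -> form s V, T0 (subst sigma (h s n))) ->
  represents A T0.
Proof.
move=> thT0 hT0; apply: represents_of_injective => // R Q thR thQ prR _.
move=> sR sQ RQ.
by rewrite (prime_determined (n := n) thR prR thQ) // => sigma _; apply: sR.
Qed.

End Subalgebra.
End Theories.

(** * The Beth property from bounded depth *)

Lemma theory_subst s (Ax : set (form s nat)) V W (tau : V -> form s W)
    (G : set (form s V)) (T : set (form s W)) a :
  theory Ax T -> (forall g, G g -> T (subst tau g)) ->
  IPL_fragment (G `|` instances Ax V) a -> T (subst tau a).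
Proof.
move=> thT GT /(IPL_subst (fun x => to_full (tau x))).
rewrite -to_full_subst => H; apply: thT.2; apply: IPL_subset H.
move=> _ [_ [g Gg <-] <-]; exists (subst tau g); rewrite ?to_full_subst //.
case: Gg => [/GT //|[b Axb [sigma ->]]].
by apply: thT.1; exists b => //; rewrite subst_subst; eexists.
Qed.

Lemma theory_consequences s (Ax : set (form s nat)) V (G : set (form s V)) :
  theory Ax [set a | IPL_fragment (G `|` instances Ax V) a].
Proof.
split=> [a Axa|a]; first by apply: IPL_hyp; exists a => //; right.
rewrite /IPL_fragment /=; move: (to_full a) => c; elim=> {c};
  try by constructor.
- by move=> _ [c Hc <-].
- by move=> c d _ Hcd _; apply: IPL_mp.
Qed.

(** The substitution to which the Beth hypothesis is applied takes values in the
    formulas over X, so that no variables beyond X and Z are involved and Y can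
    be empty. *)
Lemma Beth_rigid s (Ax : set (form s nat)) (X Z : varset)
    (G T T' : set (form s (X + Z))) :
  (forall (Y : varset) (sigma : X + Z -> form s ((X + Z) + Y)),
     (forall x : X, sigma (inl x) = Var (inl (inl x))) ->
     forall z : Z,
       IPL_fragment (((rename inl @` G) `|` (subst sigma @` G)) `|`
                     instances Ax ((X + Z) + Y)%type)
         (Iff (Var (inl (inr z))) (sigma (inr z)))) ->
  theory Ax T -> theory Ax T' -> G `<=` T -> G `<=` T' ->
  represents (range (rename inl)) T -> agree_on (range (rename inl)) T T' ->
  T = T'.
Proof.
move=> beth thT thT' sGT sGT' repT TT'.
have /choice [f Hf] : forall v : X + Z, exists phi : form s X,
    T (Iff (Var v) (rename inl phi)) /\ forall x, v = inl x -> phi = Var x.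
  case=> [x|z]; first exists (Var x).
    by split=> [|_ [->] //]; apply/(theory_iff _ _ thT).
  by have [_ [phi _ <-] Tphi] := repT (Var (inr z)); exists phi.
have fX x : f (inl x) = Var x by case: (Hf (inl x)) => _; apply.
pose rho v : form s (X + Z) := rename inl (f v).
have Trho b : T (Iff b (subst rho b)).
  by apply: (theory_replace thT) => v; case: (Hf v).
have Arho b : range (rename inl) (subst rho b).
  by exists (subst f b) => //; rewrite /rename subst_subst.
pose sigma v : form s ((X + Z) + void) := rename inl (rho v).
pose tau (v : (X + Z) + void) : form s (X + Z) :=
  match v with inl u => Var u | inr e => match e with end end.
have tauK (b : form s (X + Z)) : subst tau (rename inl b) = b.
  rewrite /rename subst_subst /=; elim: b => //= b -> c -> //.
have T'rho b : T' (Iff b (subst rho b)).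
  apply: (theory_replace thT') => -[x|z].
    by rewrite /rho fX; apply/(theory_iff _ _ thT').
  have sigmaX x : sigma (inl x) = Var (inl (inl x)).
    by rewrite /sigma /rho fX.
  have := beth void sigma sigmaX z => /(theory_subst (tau := tau) thT').
  rewrite /= tauK; apply.
  move=> _ [[g Gg <-]|[g Gg <-]]; first by rewrite tauK; apply: sGT'.
  have -> : subst tau (subst sigma g) = subst rho g.
    rewrite subst_subst; congr subst; apply: funext => v; exact: tauK.
  apply/TT' => //.
  by apply/((theory_iff _ _ thT).1 (Trho g)) => //; apply: sGT.
have iffT b := (theory_iff _ _ thT).1 (Trho b) T thT (@subset_refl _ T).
have iffT' b := (theory_iff _ _ thT').1 (T'rho b) T' thT' (@subset_refl _ T').
by apply/seteqP; split=> b; rewrite iffT iffT' TT'.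
Qed.

Lemma Beth_of_depth s (L : deducibility s) n :
  superintuitionistic L -> L nat set0 (h s n) -> infinite_Beth L.
Proof.
move=> [Ax LE] /LE hn X Z G beth z.
have thT0 := theory_consequences Ax G.
pose A : set (form s (X + Z)) := range (rename inl).
have [||||||_ [phi _ <-] Hphi] := @represents_of_depth s Ax (X + Z)%type A
    _ _ _ _ [set a | IPL_fragment (G `|` instances Ax _) a] _ n thT0 _
    (Var (inr z)); last by exists phi; apply/LE.
- by exists Top.
- by move=> _ _ [a _ <-] [b _ <-]; exists (And a b).
- by move=> _ _ [a _ <-] [b _ <-]; exists (Or a b).
- by move=> _ _ [a _ <-] [b _ <-]; exists (Imp a b).
- have sG T :
      [set a | IPL_fragment (G `|` instances Ax _) a] `<=` T -> G `<=` T.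
    by move=> sT g Gg; apply: sT; apply: IPL_hyp; exists g => //; left.
  move=> T T' thT thT' /sG sGT /sG sGT'.
  apply: (Beth_rigid (Ax := Ax) (G := G)) => // Y sigma sigmaX z'.
  exact/LE/beth.
- by move=> sigma; apply: theory_subst hn.
Qed.

(** * Tabular logics *)

(** The value of [h s k.+1] is at least that of [h s k].  If both are equal to
    some e, then x = v k.+1 satisfies x <= e, hence x -> e = T; but also
    (x -> e) <= e, so e = T.  As the values strictly increase until T is
    reached, T is reached after at most as many steps as there are elements. *)
Lemma finite_h s (A : algebra s) : finite_set [set: A] ->
  exists n, forall v : nat -> A, eval v (h s n) = Order.top.
Proof.
move=> /finite_seqP [r rP]; exists (size r) => v; apply: contrapT => ntop.
have top_imp (x y : A) : (x <= y)%O -> bimp x y = Order.top.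
  by move=> le_xy; apply/eqP; rewrite -le1x -bimpP meet1x.
pose e k := eval v (h s k).
have le_e k : (e k <= e k.+1)%O.
  by apply: le_trans (leUr _ _); rewrite -bimpP leIl.
have ntop_e k : k <= size r -> e k <> Order.top.
  move=> le_kn top_k; apply: ntop; apply/eqP; rewrite -le1x -top_k.
  apply: (homo_leq (r := fun x y => (x <= y)%O)) le_kn => // y x z.
  exact: le_trans.
have lt_e k : k < size r -> (e k < e k.+1)%O.
  move=> lt_kn; rewrite lt_neqAle le_e andbT; apply/eqP => eq_e.
  apply: (ntop_e k (ltnW lt_kn)).
  have le_x : (v k.+1 <= e k)%O by rewrite eq_e /e /= leUl.
  have le_imp : (bimp (v k.+1) (e k) <= e k)%O.
    by rewrite [leRHS]eq_e /e /= leUr.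
  by apply/eqP; rewrite -le1x -(top_imp _ _ le_x).
have sorted_e : sorted <%O%O (mkseq e (size r).+1).
  apply/(sortedP Order.top) => k; rewrite size_mkseq => lt_kn.
  by rewrite !nth_mkseq ?lt_e // ltnW.
have /(uniq_leq_size (lt_sorted_uniq sorted_e)) :
    {subset mkseq e (size r).+1 <= r}.
  by move=> x _; have : [set: A] x by []; rewrite rP.
by rewrite size_mkseq ltnn.
Qed.

Theorem corollary5p6 (s : bool) (L : deducibility s)
    (hL : superintuitionistic L)
    (hn : tabular L \/ exists n : nat, L nat set0 (h s n)) :
  infinite_Beth L.
Proof.
case: hn => [[K [varK [LK _] [A [finA [_ KA minK]]]]]|[n]]; last first.
  exact: Beth_of_depth.
have [n hA] : exists n, forall v : nat -> A, eval v (h s n) = Order.top.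
  exact: finite_h.
apply: (Beth_of_depth (n := n)) => //; apply/LK => B KB v _.
have varE : variety (models [set (h s n, Top)]) by exists [set (h s n, Top)].
by have := minK _ varE _ B KB (h s n, Top) erefl v; apply=> _ -> w; apply: hA.
Qed.
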